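(* Let $N$ be a non-negative integer and let $\alpha,\beta$ be real parameters. The biorthogonal partners $V_n(x)$ of the polynomials $$P_n(x)={}_3F_2\left({-n,\,-x,\,\alpha+1 \atop -N,\,1-\beta-n};1\right)$$ (defined by $V_n(x):=L^*P_n^*(x)$ as described in the context) are given by the rational functions $$V_n(x;\alpha,\beta,N)={}_3F_2\left({-n,\,-x,\,-\alpha-N \atop -N,\,1+\beta-x};1\right).$$
   Context: Here $n=0,1,\dots,N$, ${}_3F_2$ is the standard hypergeometric function, and $(a)_0=1$, $(a)_k=a(a+1)\cdots(a+k-1)$ is the Pochhammer symbol. Functions are considered on the linear grid $x=0,1,\dots,N$, with the scalar product $(f,g)=\sum_{x=0}^N w_x f(x)g(x)$, where $$w_x=\frac{(-\alpha-\beta-N)_N}{(-\alpha-N)_N}\,\frac{(-N)_x(-\beta)_x}{x!\,(-\alpha-\beta-N)_x}.$$ The adjoint $X^*$ of an operator $X$ is defined by $(f,Xg)=(X^*f,g)$. The operators $L,M$ are $$L f(x)=(N-x)f(x+1)+(x-N-\alpha-1)f(x),$$ $$M f(x)=A(x)f(x+1)+B(x)f(x-1)+C(x)f(x),$$ with $A(x)=(N-x)(x-\beta+1)$, $B(x)=x(\alpha+\beta+N+1-x)$, $C(x)=-(A(x)+B(x))$; the polynomials $P_n$ solve the generalized eigenvalue problem $MP_n=nLP_n$. The functions $P_n^*(x)$ are those that solve the adjoint generalized eigenvalue problem $M^*P_n^*(x)=n\,L^*P_n^*(x)$. The functions $V_n(x):=L^*P_n^*(x)$ are biorthogonal partners of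 the $P_n(x)$, that is, $\sum_{x=0}^N w_xP_n(x)V_m(x)=h_n\,\delta_{nm}$ with $h_n$ a normalization constant. *)

(* Defs.v *)
From HB Require Import structures.
From mathcomp Require Import all_boot all_order all_algebra.
From mathcomp Require Import all_classical all_reals all_analysis.

Set Implicit Arguments.
Unset Strict Implicit.
Unset Printing Implicit Defensive.

Import Order.TTheory GRing.Theory Num.Theory.
Import numFieldNormedType.Exports.
Local Open Scope ring_scope.

Definition pochhammer {R : realType} (a : R) (k : nat) : R :=
  \prod_(i < k) (a + i%:R).

(* When an upper parameter is -n the terms with k > n vanish, also where a
   lower parameter makes the denominator zero (in MathComp 0 / 0 = 0): this is
   the usual convention for terminating series with a lower parameter -N,
   n <= N. *)
Definition hypergeometric_3F2 {R : realType} (a1 a2 a3 b1 b2 z : R) : R :=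
  limn (series (fun k : nat =>
    (pochhammer a1 k * pochhammer a2 k * pochhammer a3 k)
      / (pochhammer b1 k * pochhammer b2 k) * (z ^+ k / k`!%:R))).

Definition gridfun (R : realType) (N : nat) : Type := 'I_N.+1 -> R.

Definition weight {R : realType} (N : nat) (alpha beta : R) : gridfun R N :=
  fun x =>
    pochhammer (- alpha - beta - N%:R) N / pochhammer (- alpha - N%:R) N
    * (pochhammer (- N%:R) x * pochhammer (- beta) x
       / (x`!%:R * pochhammer (- alpha - beta - N%:R) x)).

Definition scalar_product {R : realType} (N : nat) (alpha beta : R)
    (f g : gridfun R N) : R :=
  \sum_(x < N.+1) weight alpha beta x * f x * g x.

Definition is_adjoint {R : realType} (N : nat) (alpha beta : R)
    (X Xstar : gridfun R N -> gridfun R N) : Prop :=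
  forall f g : gridfun R N,
    scalar_product alpha beta f (X g) = scalar_product alpha beta (Xstar f) g.

(* The neighbours x + 1 and x - 1 are meaningless at x = N and x = 0
   respectively; there the factors N - x, A(x) and B(x) vanish. *)
Definition opL {R : realType} (N : nat) (alpha : R) (f : gridfun R N) :
    gridfun R N :=
  fun x => (N%:R - x%:R) * f (inord x.+1) + (x%:R - N%:R - alpha - 1) * f x.

Definition coefA {R : realType} (N : nat) (beta : R) (x : nat) : R :=
  (N%:R - x%:R) * (x%:R - beta + 1).

Definition coefB {R : realType} (N : nat) (alpha beta : R) (x : nat) : R :=
  x%:R * (alpha + beta + N%:R + 1 - x%:R).

Definition coefC {R : realType} (N : nat) (alpha beta : R) (x : nat) : R :=
  - (coefA N beta x + coefB N alpha beta x).

Definition opM {R : realType} (N : nat) (alpha beta : R) (f : gridfun R N) :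
    gridfun R N :=
  fun x => coefA N beta x * f (inord x.+1)
         + coefB N alpha beta x * f (inord x.-1)
         + coefC N alpha beta x * f x.

Definition gevp_solution {R : realType} (N : nat)
    (M L : gridfun R N -> gridfun R N) (lambda : R) (f : gridfun R N) : Prop :=
  (exists x, f x != 0) /\ (forall x, M f x = lambda * L f x).

Definition biorthP {R : realType} (N : nat) (alpha beta : R) (n : nat) :
    gridfun R N :=
  fun x => hypergeometric_3F2 (- n%:R) (- x%:R) (alpha + 1)
             (- N%:R) (1 - beta - n%:R) 1.

Definition biorthV {R : realType} (N : nat) (alpha beta : R) (n : nat) :
    gridfun R N :=
  fun x => hypergeometric_3F2 (- n%:R) (- x%:R) (- alpha - N%:R)
             (- N%:R) (1 + beta - x%:R) 1.

(* Main.v *)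
Require Import Defs.
From HB Require Import structures.
From mathcomp Require Import all_boot all_order all_algebra.
From mathcomp Require Import all_classical all_reals all_analysis.
From mathcomp Require Import ring.

Set Implicit Arguments.
Unset Strict Implicit.
Unset Printing Implicit Defensive.

Import Order.TTheory GRing.Theory Num.Theory.
Import numFieldNormedType.Exports.
Local Open Scope ring_scope.

(* On the functions theta_j(x) = binomial(N - x, j) the operator L is diagonal
   and M is bidiagonal:
     L theta_j = - (alpha + 1 + j) theta_j,
     M theta_j = - j (alpha + 1 + j) theta_j
                 + (alpha + beta + j) (N - j + 1) theta_(j - 1).
   Hence M* P = n L* P holds iff the moments v_j = (L* P, theta_j) satisfy
     (j - n) (alpha + j) v_j = (alpha + beta + j) (N - j + 1) v_(j - 1),
   which determines L* P up to a scalar.  Two applications of Chu-Vandermonde,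
   first over x and then over the summation index of the 3F2, evaluate
     (V_n, theta_j) = theta_moment j * (- j)_n / (- N)_n,
   which solves this recurrence.  Orthogonality for n <> m follows from the two
   eigenvalue equations; h_n <> 0 since the matrix (V_m, theta_j) is triangular
   with nonzero diagonal. *)

(** * Pochhammer symbols and the Chu-Vandermonde sum *)

Lemma pochhammer0 (R : realType) (a : R) : pochhammer a 0 = 1.
Proof. by rewrite /pochhammer big_ord0. Qed.

Lemma pochhammerS (R : realType) (a : R) k :
  pochhammer a k.+1 = pochhammer a k * (a + k%:R).
Proof. by rewrite /pochhammer big_ord_recr. Qed.

Lemma pochhammerD (R : realType) (a : R) m k :
  pochhammer a (m + k) = pochhammer a m * pochhammer (a + m%:R) k.
Proof.
elim: k => [|k IHk]; first by rewrite addn0 pochhammer0 mulr1.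
by rewrite addnS !pochhammerS IHk natrD; ring.
Qed.

Lemma pochhammerSl (R : realType) (a : R) k :
  pochhammer a k.+1 = a * pochhammer (a + 1) k.
Proof. by rewrite -add1n pochhammerD pochhammerS pochhammer0 addr0 mul1r. Qed.

Lemma pochhammer_neq0 (R : realType) (a : R) k :
  (forall i, (i < k)%N -> a + i%:R != 0) -> pochhammer a k != 0.
Proof. by move=> ha; apply/prodf_neq0 => i _; apply: ha. Qed.

Lemma pochhammer_neq0_le (R : realType) (a : R) m k :
  (k <= m)%N -> pochhammer a m != 0 -> pochhammer a k != 0.
Proof. by move=> /subnKC <-; rewrite pochhammerD mulf_eq0 negb_or => /andP[]. Qed.

(** The product is read backwards with the sign of each factor changed. *)
Lemma pochhammer_reflect (R : realType) (a : R) k :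
  pochhammer a k = (-1) ^+ k * pochhammer (1 - a - k%:R) k.
Proof.
elim: k a => [|k IHk] a; first by rewrite !pochhammer0 mulr1.
rewrite pochhammerSl IHk pochhammerS exprS -natr1.
have -> : 1 - (a + 1) - k%:R = 1 - a - (k%:R + 1) :> R by ring.
ring.
Qed.

(** Each factor -n + i equals -(n - i). For k > n both sides are zero, which is what cuts the sums
    off. *)
Lemma pochhammerN_nat (R : realType) (n k : nat) :
  pochhammer (- n%:R : R) k = (-1) ^+ k * (n ^_ k)%:R.
Proof.
elim: k => [|k IHk]; first by rewrite pochhammer0 ffactn0 mulr1.
rewrite pochhammerS IHk ffactnSr exprS natrM.
have [lekn|ltnk] := leqP k n; first by rewrite natrB //; ring.
by rewrite ffact_small //; ring.
Qed.

(** This is 2F1(-n, a; c; 1) = (c - a)_n / (c)_n multiplied through by (c)_n, using (c)_n / (c)_k =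
    (c + k)_(n - k). The induction on n applies Pascal's rule to the binomial coefficient. *)
Lemma chu_vandermonde (R : realType) (n : nat) (a c : R) :
  \sum_(k < n.+1) 'C(n, k)%:R * (-1) ^+ k * pochhammer a k
     * pochhammer (c + k%:R) (n - k) = pochhammer (c - a) n.
Proof.
elim: n a c => [|n IHn] a c.
  by rewrite big_ord_recl big_ord0 /= !pochhammer0 bin0 expr0; ring.
rewrite big_ord_recl /= bin0 expr0 pochhammer0 addr0 !mul1r subn0.
under eq_bigr => i _ do
  rewrite /bump /= add1n binS natrD subSS !mulrDl exprS pochhammerSl -natr1.
rewrite big_split /=.
(* The shifted half of Pascal's rule is the sum for a + 1 and c + 1, whose difference is still c -
   a. *)
have -> : \sum_(i < n.+1) 'C(n, i)%:R * (-1 * (-1) ^+ i)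
    * (a * pochhammer (a + 1) i) * pochhammer (c + (i%:R + 1)) (n - i)
    = - a * pochhammer (c - a) n.
  have -> : c - a = (c + 1) - (a + 1) by ring.
  rewrite -IHn mulr_sumr; apply: eq_bigr => i _.
  have -> : c + (i%:R + 1) = c + 1 + i%:R by ring.
  ring.
rewrite [X in _ + (X + _)]big_ord_recr /= bin_small // !mul0r addr0 addrA.
(* In the other half every (c + k)_(n + 1 - k) has the same last factor c + n. *)
have -> : pochhammer c n.+1 + \sum_(i < n) 'C(n, i.+1)%:R * (-1 * (-1) ^+ i)
    * (a * pochhammer (a + 1) i) * pochhammer (c + (i%:R + 1)) (n - i)
    = (c + n%:R) * pochhammer (c - a) n.
  rewrite -IHn mulr_sumr big_ord_recl /= bin0 expr0 addr0 pochhammer0 subn0.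
  rewrite pochhammerS; congr (_ + _); first by ring.
  apply: eq_bigr => i _.
  rewrite /bump /= add1n exprS pochhammerSl -natr1 -[in LHS](subnSK (ltn_ord i)).
  rewrite pochhammerS natrB // -natr1; ring.
rewrite pochhammerS; ring.
Qed.

(** * The 3F2 series as a finite sum *)

Lemma hypergeometric_3F2_terminating (R : realType) (n : nat)
    (a2 a3 b1 b2 : R) :
  hypergeometric_3F2 (- n%:R) a2 a3 b1 b2 1
  = \sum_(k < n.+1) pochhammer (- n%:R) k * pochhammer a2 k * pochhammer a3 k
      / (pochhammer b1 k * pochhammer b2 k * k`!%:R).
Proof.
rewrite /hypergeometric_3F2; set F := (F in series F).
(* The partial sums are constant from [n.+1] on: the numerator is zero for k > n, whatever the
   denominator. *)
apply: lim_near_cst => //; exists n.+1 => // m /= lenm.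
rewrite /series /= (big_cat_nat (n := n.+1)) //=.
rewrite [X in _ + X]big_nat_cond [X in _ + X]big1 ?addr0; last first.
  move=> k /andP[/andP[ltnk _] _].
  by rewrite /F pochhammerN_nat ffact_small // mulr0 !mul0r.
rewrite big_mkord; apply: eq_bigr => k _.
by rewrite /F expr1n div1r !invfM !mulrA.
Qed.

(** * The operators L and M on the binomial basis *)

Lemma opL_nat (R : realType) (N : nat) (alpha : R) (f : gridfun R N)
    (F : nat -> R) (x : 'I_N.+1) :
  (forall z : 'I_N.+1, f z = F z) ->
  opL alpha f x
  = (N%:R - x%:R) * F x.+1 + (x%:R - N%:R - alpha - 1) * F x.
Proof.
move=> fF; rewrite /opL !fF.
(* At x = N the values of f and F at the right neighbour may differ, but their factor N - x is
   zero. *)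
have [ltxN|leNx] := ltnP x N; first by rewrite inordK.
have -> : x = N :> nat by apply/eqP; rewrite eqn_leq leNx -ltnS ltn_ord.
by rewrite subrr !mul0r.
Qed.

(* [coefB] and [coefC] are qualified: lemmas of these names on polynomial
   coefficients shadow the definitions. *)
Lemma opM_nat (R : realType) (N : nat) (alpha beta : R) (f : gridfun R N)
    (F : nat -> R) (x : 'I_N.+1) :
  (forall z : 'I_N.+1, f z = F z) ->
  opM alpha beta f x
  = Defs.coefA N beta x * F x.+1 + Defs.coefB N alpha beta x * F x.-1
    + Defs.coefC N alpha beta x * F x.
Proof.
have ltxp : (x.-1 < N.+1)%N by apply: leq_ltn_trans (leq_pred _) (ltn_ord x).
move=> fF; rewrite /opM !fF (inordK ltxp).
have [ltxN|leNx] := ltnP x N; first by rewrite inordK.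
have -> : x = N :> nat by apply/eqP; rewrite eqn_leq leNx -ltnS ltn_ord.
by rewrite /Defs.coefA subrr !mul0r.
Qed.

Lemma natr_ffactS (R : realType) (x k : nat) :
  (x ^_ k.+1)%:R = (x%:R - k%:R) * (x ^_ k)%:R :> R.
Proof.
rewrite ffactnSr natrM mulrC.
have [lekx|ltxk] := leqP k x; first by rewrite natrB.
by rewrite ffact_small // !mulr0.
Qed.

Definition theta {R : realType} (N j : nat) : gridfun R N :=
  fun x => 'C(N - x, j)%:R.

Lemma mulr_bin_pred (R : realType) (y k : nat) :
  y%:R * 'C(y.-1, k)%:R = (y%:R - k%:R) * 'C(y, k)%:R :> R.
Proof.
case: y => [|y] /=.
  by case: k => [|k]; rewrite ?mul0r ?subrr ?mul0r // bin0n mulr0.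
rewrite -natrM mul_bin_down natrM.
have [lek|ltk] := leqP k y.+1; first by rewrite natrB.
by rewrite bin_small // !mulr0.
Qed.

Lemma mulr_binS (R : realType) (y k : nat) :
  k.+1%:R * 'C(y, k.+1)%:R = (y%:R - k%:R) * 'C(y, k)%:R :> R.
Proof.
rewrite -natrM mul_bin_left natrM.
have [lek|ltk] := leqP k y; first by rewrite natrB.
by rewrite bin_small // !mulr0.
Qed.

(** With y = N - x, the identity y C(y - 1, j) = (y - j) C(y, j) turns the shifted term into a
    multiple of theta_j. *)
Lemma opL_theta (R : realType) (N : nat) (alpha : R) (j : nat) (x : 'I_N.+1) :
  opL alpha (theta j) x = - (alpha + 1 + j%:R) * theta j x.
Proof.
have lexN : (x <= N)%N by rewrite -ltnS.
rewrite (opL_nat _ (F := fun z => 'C(N - z, j)%:R)) // /theta subnS.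
rewrite -natrB // mulr_bin_pred natrB //; ring.
Qed.

Lemma opM_theta0 (R : realType) (N : nat) (alpha beta : R) (x : 'I_N.+1) :
  opM alpha beta (theta 0) x = 0.
Proof.
rewrite (opM_nat _ _ (F := fun z => 'C(N - z, 0)%:R)) // !bin0 /Defs.coefC; ring.
Qed.

Lemma opM_thetaS (R : realType) (N : nat) (alpha beta : R) (j : nat)
    (x : 'I_N.+1) :
  opM alpha beta (theta j.+1) x
  = - j.+1%:R * (alpha + 1 + j.+1%:R) * theta j.+1 x
    + (alpha + beta + j.+1%:R) * (N%:R - j%:R) * theta j x.
Proof.
have lexN : (x <= N)%N by rewrite -ltnS.
rewrite (opM_nat _ _ (F := fun z => 'C(N - z, j.+1)%:R)) // /theta.
(* Pascal's rule for N - x + 1; at x = 0, where the predecessor is truncated, the coefficient B is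
   zero. *)
have -> : Defs.coefB N alpha beta x * 'C(N - x.-1, j.+1)%:R
   = Defs.coefB N alpha beta x * ('C(N - x, j.+1)%:R + 'C(N - x, j)%:R).
  case: (val x) lexN => [|z] lezN; first by rewrite /Defs.coefB !mul0r.
  by rewrite -natrD -binS /= subnSK.
have hA : Defs.coefA N beta x * 'C(N - x.+1, j.+1)%:R
   = (x%:R - beta + 1) * (N%:R - x%:R - j.+1%:R) * 'C(N - x, j.+1)%:R.
  rewrite subnS /Defs.coefA -natrB // mulrAC mulr_bin_pred natrB //; ring.
have := mulr_binS R (N - x) j; rewrite natrB // => /eqP; rewrite -subr_eq0 => /eqP r.
rewrite hA; apply/eqP; rewrite -subr_eq0; apply/eqP.
(* The two sides differ by exactly this factor times the relation [r] between neighbouring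
   binomials. *)
rewrite -[RHS](mulr0 (alpha + beta + j.+1%:R - x%:R)) -r /Defs.coefC /Defs.coefA /Defs.coefB.
rewrite -natr1. ring.
Qed.

(** * Falling factorial expansion of P_n and its eigenvalue equation *)

Lemma biorthP_sum (R : realType) (N : nat) (alpha beta : R) (n : nat)
    (x : 'I_N.+1) :
  biorthP alpha beta n x
  = \sum_(k < n.+1) pochhammer (- n%:R) k * pochhammer (alpha + 1) k
      / (pochhammer (1 - beta - n%:R) k * k`!%:R * (N ^_ k)%:R)
      * (x ^_ k)%:R.
Proof.
rewrite /biorthP hypergeometric_3F2_terminating; apply: eq_bigr => k _.
rewrite (pochhammerN_nat _ x) (pochhammerN_nat _ N) !invfM -exprVn invrN1.
(* The signs of (-x)_k and (-N)_k multiply to 1. *)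
have e := sqrr_sign R k; rewrite -[RHS]mul1r -[X in _ = X * _]e; ring.
Qed.

(** In the basis of falling factorials both operators are bidiagonal, so M P = n L P becomes a
    two-term recurrence for the coefficients of P. *)
Lemma opL_ffact (R : realType) (N : nat) (alpha : R) (k x : nat) :
  (N%:R - x%:R) * (x.+1 ^_ k.+1)%:R
    + (x%:R - N%:R - alpha - 1) * (x ^_ k.+1)%:R
  = k.+1%:R * (N%:R - k%:R) * (x ^_ k)%:R
    - (k.+1%:R + alpha + 1) * (x ^_ k.+1)%:R :> R.
Proof. rewrite ffactnS /= natrM natr_ffactS -!natr1; ring. Qed.

Lemma opM_ffact (R : realType) (N : nat) (alpha beta : R) (k x : nat) :
  Defs.coefA N beta x * (x.+1 ^_ k.+1)%:R
    + Defs.coefB N alpha beta x * (x.-1 ^_ k.+1)%:R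
    + Defs.coefC N alpha beta x * (x ^_ k.+1)%:R
  = k.+1%:R * (k.+1%:R - beta) * (N%:R - k%:R) * (x ^_ k)%:R
    - k.+1%:R * (k.+1%:R + alpha + 1) * (x ^_ k.+1)%:R :> R.
Proof.
(* The factor x of B completes the falling factorial to order k + 2, also at x = 0. *)
have -> : Defs.coefB N alpha beta x * (x.-1 ^_ k.+1)%:R
   = (alpha + beta + N%:R + 1 - x%:R) * (x ^_ k.+2)%:R.
  rewrite /Defs.coefB (ffactnS x k.+1) natrM; ring.
rewrite ffactnS /= natrM !natr_ffactS /Defs.coefC /Defs.coefA /Defs.coefB -!natr1; ring.
Qed.

Lemma biorthP_gevp_eq (R : realType) (N : nat) (alpha beta : R)
    (hbeta_neg : forall j : nat, (j < N)%N -> beta != - j%:R)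
    (n : nat) (lenN : (n <= N)%N) (x : 'I_N.+1) :
  opM alpha beta (biorthP alpha beta n) x
  = n%:R * opL alpha (biorthP alpha beta n) x.
Proof.
pose b k : R := pochhammer (- n%:R) k * pochhammer (alpha + 1) k
      / (pochhammer (1 - beta - n%:R) k * k`!%:R * (N ^_ k)%:R).
(* The term ratio of the 3F2. It says that in (M - n L) P_n the lowered part of term k + 1 cancels
   the diagonal part of term k. *)
have bS k : (k < n)%N -> b k.+1 * k.+1%:R * (k.+1%:R - beta - n%:R)
    * (N%:R - k%:R) = b k * (k%:R - n%:R) * (k%:R + alpha + 1).
  move=> ltkn; rewrite /b !pochhammerS factS natr_ffactS natrM.
  have h1 : (N%:R - k%:R : R) != 0.
    by rewrite subr_eq0 eqr_nat gtn_eqF // (leq_trans ltkn).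
  (* A zero here would mean beta = -(n - i - 1). *)
  have h2 i : (i < n)%N -> 1 - beta - n%:R + i%:R != 0 :> R.
    move=> ltin; apply: contraTneq (hbeta_neg (n - i.+1)%N _) => [h|].
      by rewrite negbK natrB // -(natr1 i) -[X in X == _]addr0 -h; apply/eqP; ring.
    by rewrite -subSn // subSS (leq_trans (leq_subr _ _)).
  have h3 : pochhammer (1 - beta - n%:R) k != 0.
    by apply: pochhammer_neq0 => i ltik; apply: h2; apply: ltn_trans ltkn.
  have h4 : (N ^_ k)%:R != 0 :> R.
    by rewrite pnatr_eq0 -lt0n ffact_gt0 (leq_trans (ltnW ltkn)).
  have h5 := h2 k ltkn.
  have h6 : k`!%:R != 0 :> R by rewrite pnatr_eq0 -lt0n fact_gt0.
  rewrite -!natr1; field; rewrite h1 h3 h4 h5 h6 natr1 pnatr_eq0 //.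
pose F m z : R := \sum_(k < m.+1) b k * (z ^_ k)%:R.
have PF (z : 'I_N.+1) : biorthP alpha beta n z = F n z by apply: biorthP_sum.
rewrite (opM_nat alpha beta x PF) (opL_nat alpha x PF).
pose D m := Defs.coefA N beta x * F m x.+1 + Defs.coefB N alpha beta x * F m x.-1
    + Defs.coefC N alpha beta x * F m x
  - n%:R * ((N%:R - x%:R) * F m x.+1 + (x%:R - N%:R - alpha - 1) * F m x).
(* The terms of the sum telescope; the remainder has the factor [m - n]. *)
suff /(_ n (leqnn n)) : forall m, (m <= n)%N ->
    D m = - b m * (m%:R - n%:R) * (m%:R + alpha + 1) * (x ^_ m)%:R.
  by rewrite /D subrr mulr0 !mul0r => /eqP; rewrite subr_eq0 => /eqP.
elim=> [_|m IHm ltmn].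
  by rewrite /D /F !big_ord_recr !big_ord0 /= !ffactn0 /Defs.coefC; ring.
have FS z : F m.+1 z = F m z + b m.+1 * (z ^_ m.+1)%:R by rewrite /F big_ord_recr.
have -> : D m.+1 = D m + b m.+1 * (Defs.coefA N beta x * (x.+1 ^_ m.+1)%:R
    + Defs.coefB N alpha beta x * (x.-1 ^_ m.+1)%:R
    + Defs.coefC N alpha beta x * (x ^_ m.+1)%:R - n%:R *
    ((N%:R - x%:R) * (x.+1 ^_ m.+1)%:R
    + (x%:R - N%:R - alpha - 1) * (x ^_ m.+1)%:R)).
  by rewrite /D !FS; ring.
rewrite opL_ffact opM_ffact (IHm (ltnW ltmn)) !mulNr -bS //; ring.
Qed.

(** * Moments of V_n by two Chu-Vandermonde sums *)

(** The value of (V_0, theta_j), that is, the sum of w_x theta_j(x), since V_0 = 1. *)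
Definition theta_moment {R : realType} (N : nat) (alpha beta : R) (j : nat) : R :=
  pochhammer (- alpha - beta - N%:R) N / pochhammer (- alpha - N%:R) N
  * 'C(N, j)%:R * pochhammer (- alpha - N%:R) (N - j)
  / pochhammer (- alpha - beta - N%:R) (N - j).

(** Puts the summand at x = k + i into Chu-Vandermonde form in i, with N - j - k for n, -beta for a
    and -alpha - beta - N + k for c. Reflecting the last k factors of (-beta)_(k + i) cancels the
    denominator that depends on x. *)
Lemma weight_term (R : realType) (alpha beta : R) (N j k i : nat)
    (hc : pochhammer (- alpha - beta - N%:R) N != 0)
    (hbeta : forall x, (x <= N)%N -> pochhammer (1 + beta - x%:R) x != 0)
    (hkij : (k + i <= N - j)%N) (lejN : (j <= N)%N) (K : R) :
  K * (pochhammer (- N%:R) (k + i) * pochhammer (- beta) (k + i)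
     / ((k + i)`!%:R * pochhammer (- alpha - beta - N%:R) (k + i)))
   * (pochhammer (- (k + i)%:R) k / pochhammer (1 + beta - (k + i)%:R) k)
   * 'C(N - (k + i), j)%:R
  = K * 'C(N, j)%:R * (-1) ^+ k * ((N - j) ^_ k)%:R
     / pochhammer (- alpha - beta - N%:R) (N - j)
    * ('C(N - j - k, i)%:R * (-1) ^+ i * pochhammer (- beta) i
       * pochhammer (- alpha - beta - N%:R + k%:R + i%:R) (N - j - k - i)).
Proof.
set c := - alpha - beta - N%:R in hc *.
have e : (-1) ^+ k * (-1) ^+ k = 1 :> R by rewrite -expr2 sqrr_sign.
have hx : (k + i <= N)%N by apply: leq_trans hkij (leq_subr _ _).
have -> : pochhammer (- beta) (k + i)
    = (-1) ^+ k * pochhammer (- beta) i * pochhammer (1 + beta - (k + i)%:R) k.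
  rewrite addnC pochhammerD [X in _ * X]pochhammer_reflect natrD.
  have -> : 1 - (- beta + i%:R) - k%:R = 1 + beta - (i%:R + k%:R) by ring.
  ring.
have -> : pochhammer c (N - j)
   = pochhammer c (k + i) * pochhammer (c + k%:R + i%:R) (N - j - k - i).
  by rewrite -addrA -natrD -pochhammerD -subnDA subnKC.
have hck : pochhammer c (k + i) != 0 by apply: pochhammer_neq0_le hc.
have hcj : pochhammer (c + k%:R + i%:R) (N - j - k - i) != 0.
  have := pochhammer_neq0_le (leq_subr j N) hc.
  rewrite -{1}(subnKC hkij) pochhammerD mulf_eq0 negb_or => /andP[_].
  by rewrite natrD addrA subnDA.
have hb : pochhammer (1 + beta - (k + i)%:R) k != 0.
  by apply: pochhammer_neq0_le (leq_addr _ _) (hbeta _ hx).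
rewrite !pochhammerN_nat exprD.
have fne m : m`!%:R != 0 :> R by rewrite pnatr_eq0 -lt0n fact_gt0.
(* Both sides equal N! / (i! j! (N - k - i - j)!); the proof clears all factorials. *)
have comb : (N ^_ (k + i) * (k + i) ^_ k * 'C(N - (k + i), j))%:R / (k + i)`!%:R
    = ('C(N, j) * (N - j) ^_ k * 'C(N - j - k, i))%:R :> R.
  apply: (mulIf (fne (k + i)%N)); rewrite divfK // -natrM; congr _%:R.
  have leji : (j <= N - (k + i))%N by rewrite leq_subCr.
  have lek : (k <= N - j)%N by apply: leq_trans (leq_addr _ _) hkij.
  have lei : (i <= N - j - k)%N by rewrite leq_subRL.
  apply/eqP.
  rewrite -(eqn_pmul2r (fact_gt0 (N - (k + i)))) -(eqn_pmul2r (fact_gt0 j)).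
  rewrite -(eqn_pmul2r (fact_gt0 (N - (k + i) - j))).
  rewrite -(eqn_pmul2r (fact_gt0 i)).
  have f1 := ffact_fact hx; have f2 := ffact_fact (leq_addr i k).
  have f3 := bin_fact leji; have f4 := bin_fact lejN.
  have f5 := ffact_fact lek; have f6 := bin_fact lei.
  move: f1 f2 f3 f4 f5 f6; rewrite addKn.
  have -> : (N - (k + i) - j = N - j - k - i)%N by rewrite subnAC subnDA.
  move=> f1 f2 f3 f4 f5 f6; apply/eqP.
  transitivity (N`! * (k + i)`! * (N - (k + i))`!)%N.
    rewrite -[in RHS]f3 -f1 -f2; ring.
  rewrite -f4 -f5 -f6; ring.
rewrite !natrM in comb.
have -> : forall u v w : R, K * ((-1) ^+ k * (-1) ^+ i * (N ^_ (k + i))%:R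
   * ((-1) ^+ k * u * v) / ((k + i)`!%:R * w))
   * ((-1) ^+ k * ((k + i) ^_ k)%:R / v) * 'C(N - (k + i), j)%:R
   = K * (-1) ^+ k * (-1) ^+ i * u * (v / v) / w * ((-1) ^+ k * (-1) ^+ k) *
     ((N ^_ (k + i))%:R * ((k + i) ^_ k)%:R * 'C(N - (k + i), j)%:R / (k + i)`!%:R).
  by move=> u v w; rewrite !invfM; ring.
rewrite comb e divff //; field; rewrite hck hcj //.
Qed.

(** The first Chu-Vandermonde sum, over x: it handles one term of the 3F2 at a time. *)
Lemma weight_theta_sum (R : realType) (alpha beta : R) (N j k : nat)
    (hc : pochhammer (- alpha - beta - N%:R) N != 0)
    (hd : pochhammer (- alpha - N%:R) N != 0)
    (hbeta : forall x, (x <= N)%N -> pochhammer (1 + beta - x%:R) x != 0)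
    (lejN : (j <= N)%N) (lekN : (k <= N)%N) :
  \sum_(x < N.+1) weight alpha beta x
     * (pochhammer (- x%:R) k / pochhammer (1 + beta - x%:R) k) * theta j x
  = theta_moment N alpha beta j
    * (pochhammer (- (N - j)%:R) k / pochhammer (- alpha - N%:R) k).
Proof.
rewrite /theta_moment /weight /theta.
set c := - alpha - beta - N%:R; set d := - alpha - N%:R; set K := _ / _.
pose F x := K * (pochhammer (- N%:R) x * pochhammer (- beta) x
     / (x`!%:R * pochhammer c x))
   * (pochhammer (- x%:R) k / pochhammer (1 + beta - x%:R) k)
   * 'C(N - x, j)%:R.
rewrite -(big_mkord xpredT F) pochhammerN_nat.
(* Only k <= x <= N - j contributes: (-x)_k vanishes below this range and theta_j above it. *)
have F0 x : (x <= N)%N -> (x < k)%N || (N - j < x)%N -> F x = 0.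
  move=> lexN /orP[] h; rewrite /F.
    by rewrite (pochhammerN_nat R x k) (ffact_small h) mulr0 mul0r mulr0 mul0r.
  by rewrite (bin_small (n := N - x)) ?mulr0 // ltn_subCl.
(* If N - j < k the range is empty, and (-(N - j))_k on the right is zero as well. *)
have [ltjk|lekj] := ltnP (N - j) k.
  rewrite (ffact_small ltjk) !(mulr0, mul0r) big_nat big1 // => x /andP[_ lexN].
  by apply: F0 => //; case: ltnP => //=; apply: leq_trans ltjk.
rewrite (big_cat_nat (n := k)) //=; last exact: leqW.
rewrite big_nat big1 ?add0r; last by move=> x /andP[_ h]; rewrite F0 ?h // (leq_trans (ltnW h)).
rewrite (big_cat_nat (n := (N - j).+1)) //=; [|exact: leqW|by rewrite ltnS leq_subr].
rewrite [X in _ + X]big_nat [X in _ + X]big1 ?addr0; last first.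
  by move=> x /andP[h h']; rewrite F0 ?h ?orbT.
rewrite -{1}[k]add0n big_addn subSn // big_mkord.
under eq_bigr => i _.
  rewrite addnC /F weight_term //; last by rewrite -leq_subRL // -ltnS.
  over.
rewrite -mulr_sumr chu_vandermonde opprK.
(* As c + beta = d, the value of the sum is the tail of (d)_(N - j) after its first k factors. *)
have -> : pochhammer d (N - j)
    = pochhammer d k * pochhammer (c + k%:R + beta) (N - j - k).
  rewrite -{1}(subnKC lekj) pochhammerD; congr (_ * pochhammer _ _).
  by rewrite /d /c; ring.
have hdk := pochhammer_neq0_le lekN hd.
have hcj := pochhammer_neq0_le (leq_subr j N) hc.
by rewrite -/c; field; rewrite hdk hcj.
Qed.

(** The sum over x leaves (-alpha - N)_k in the denominator, which cancels that parameter of the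
    3F2. What remains is a 2F1 in k, the second Chu-Vandermonde sum. *)
Lemma biorthV_theta (R : realType) (alpha beta : R) (N j m : nat)
    (hc : pochhammer (- alpha - beta - N%:R) N != 0)
    (hd : pochhammer (- alpha - N%:R) N != 0)
    (hbeta : forall x, (x <= N)%N -> pochhammer (1 + beta - x%:R) x != 0)
    (lejN : (j <= N)%N) (lemN : (m <= N)%N) :
  scalar_product alpha beta (biorthV alpha beta m) (theta (N := N) j)
  = theta_moment N alpha beta j
    * (pochhammer (- j%:R) m / pochhammer (- N%:R) m).
Proof.
rewrite /scalar_product.
pose b k : R := pochhammer (- m%:R) k * pochhammer (- alpha - N%:R) k
   / (pochhammer (- N%:R) k * k`!%:R).
have -> : \sum_(x < N.+1) weight alpha beta x * biorthV alpha beta m x * theta j x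
   = \sum_(k < m.+1) b k * \sum_(x < N.+1) weight alpha beta x
     * (pochhammer (- x%:R) k / pochhammer (1 + beta - x%:R) k) * theta j x.
  under [RHS]eq_bigr => k _ do rewrite mulr_sumr.
  rewrite [RHS]exchange_big /=; apply: eq_bigr => x _.
  rewrite /biorthV hypergeometric_3F2_terminating mulr_sumr mulr_suml.
  by apply: eq_bigr => k _; rewrite /b !invfM; ring.
have hN k : (k <= N)%N -> pochhammer (- N%:R : R) k != 0.
  move=> lekN; rewrite pochhammerN_nat mulf_neq0 // ?signr_eq0 //.
  by rewrite pnatr_eq0 -lt0n ffact_gt0.
(* Writes -j as c - a with c = -N and a = -(N - j). *)
have -> : pochhammer (- j%:R : R) m = pochhammer (- N%:R - - (N - j)%:R) m.
  by congr pochhammer; rewrite natrB //; ring.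
rewrite -chu_vandermonde mulr_suml mulr_sumr; apply: eq_bigr => k _.
have lekm : (k <= m)%N by rewrite -ltnS.
have lekN := leq_trans lekm lemN.
rewrite weight_theta_sum // /b pochhammerN_nat -bin_ffact natrM.
have -> : pochhammer (- N%:R : R) m
    = pochhammer (- N%:R) k * pochhammer (- N%:R + k%:R) (m - k).
  by rewrite -pochhammerD subnKC.
have h1 := pochhammer_neq0_le lekN hd.
have h2 := hN k lekN.
have h3 : k`!%:R != 0 :> R by rewrite pnatr_eq0 -lt0n fact_gt0.
have h4 : pochhammer (- N%:R + k%:R) (m - k) != 0 :> R.
  by have := hN m lemN; rewrite -{1}(subnKC lekm) pochhammerD mulf_eq0 negb_or => /andP[].
by field; rewrite h1 h2 h3 h4.
Qed.

(** Passing from j to j + 1 drops the last factors -(alpha + j + 1) and -(alpha + beta + j + 1) of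
    the two Pochhammer symbols; their signs cancel. *)
Lemma theta_momentS (R : realType) (alpha beta : R) (N j : nat)
    (hc : pochhammer (- alpha - beta - N%:R) N != 0)
    (ltjN : (j < N)%N) :
  theta_moment N alpha beta j.+1 * (alpha + j.+1%:R) * j.+1%:R
  = theta_moment N alpha beta j * (N%:R - j%:R) * (alpha + beta + j.+1%:R).
Proof.
rewrite /theta_moment.
set c := - alpha - beta - N%:R in hc *; set d := - alpha - N%:R.
set K := pochhammer c N / pochhammer d N.
have := mulr_binS R N j.
have hcj := pochhammer_neq0_le (leq_subr j N) hc.
have e : (N - j = (N - j.+1).+1)%N by rewrite subnSK.
move: hcj; rewrite e !pochhammerS natrB // mulf_eq0 negb_or => /andP[h1 h2] hbin.
have ec : c + (N%:R - j.+1%:R) = - (alpha + beta + j.+1%:R) by rewrite /c; ring.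
rewrite ec; rewrite ec oppr_eq0 in h2.
have -> : d + (N%:R - j.+1%:R) = - (alpha + j.+1%:R) by rewrite /d; ring.
transitivity (K * (j.+1%:R * 'C(N, j.+1)%:R) * pochhammer d (N - j.+1)
  / pochhammer c (N - j.+1) * (alpha + j.+1%:R)).
  by ring.
by rewrite hbin; move: h2; set s := alpha + beta + _ => h2; field; rewrite h1 h2.
Qed.

Lemma theta_moment_neq0 (R : realType) (alpha beta : R) (N j : nat)
    (hc : pochhammer (- alpha - beta - N%:R) N != 0)
    (hd : pochhammer (- alpha - N%:R) N != 0) (lejN : (j <= N)%N) :
  theta_moment N alpha beta j != 0.
Proof.
rewrite /theta_moment !mulf_neq0 ?invr_eq0 //.
- by rewrite pnatr_eq0 -lt0n bin_gt0.
- by apply: pochhammer_neq0_le hd; apply: leq_subr.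
- by apply: pochhammer_neq0_le hc; apply: leq_subr.
Qed.

Lemma weight_neq0 (R : realType) (alpha beta : R) (N : nat)
    (hc : pochhammer (- alpha - beta - N%:R) N != 0)
    (hd : pochhammer (- alpha - N%:R) N != 0)
    (hb : pochhammer (- beta) N != 0) (x : 'I_N.+1) :
  weight alpha beta x != 0.
Proof.
have lexN : (x <= N)%N by rewrite -ltnS.
have h1 : pochhammer (- N%:R : R) x != 0.
  by rewrite pochhammerN_nat mulf_eq0 signr_eq0 pnatr_eq0 -lt0n ffact_gt0.
have h2 : x`!%:R != 0 :> R by rewrite pnatr_eq0 -lt0n fact_gt0.
have [h3 h4] := (pochhammer_neq0_le lexN hb, pochhammer_neq0_le lexN hc).
by rewrite /weight !(mulf_eq0, invr_eq0, negb_or) hc hd h1 h2 h3 h4.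
Qed.

(** * Functions on the grid and their moments against the binomial basis *)

Lemma theta_mx_unit (R : realType) (N : nat) :
  (\matrix_(i < N.+1, j < N.+1) theta j i : 'M[R]_N.+1) \in unitmx.
Proof.
rewrite -row_free_unit; apply: inj_row_free => v vA0.
suff v0 n : forall i : 'I_N.+1, (i <= n)%N -> v 0 i = 0.
  by apply/rowP => i; rewrite mxE (v0 i).
elim: n.+1 {-2}n (ltnSn n) => // {}n IHn k ltkn i leik.
(* The matrix is anti-triangular with ones on the antidiagonal. In column N - i the rows below i are
   zero, and the entries of v before i vanish by induction, so v_i = 0. *)
have ltNi : (N - i < N.+1)%N by rewrite ltnS leq_subr.
have := congr1 (fun M : 'rV_N.+1 => M 0 (Ordinal ltNi)) vA0.
rewrite !mxE (bigD1 i) //= mxE /theta /= binn mulr1 big1 ?addr0 // => l neli.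
rewrite mxE /theta /=; have [ltli|leil] := ltnP l i.
  by rewrite (IHn l) ?mul0r // (leq_trans ltli) // (leq_trans leik).
have ltil : (i < l)%N by rewrite ltn_neqAle leil eq_sym neli.
by rewrite bin_small ?mulr0 // ltn_sub2l // (leq_trans ltil) // -ltnS.
Qed.

Lemma theta_expansion (R : realType) (N : nat) (f : gridfun R N) :
  exists a : 'I_N.+1 -> R, forall x, f x = \sum_j a j * theta j x.
Proof.
pose A : 'M[R]_N.+1 := \matrix_(i, j) theta j i.
pose a := invmx A *m (\col_i f i).
exists (fun j => a j 0) => x.
have /colP/(_ x) : A *m a = \col_i f i by rewrite mulKVmx // theta_mx_unit.
by rewrite !mxE => <-; apply: eq_bigr => j _; rewrite mxE mulrC.
Qed.

(** The linear system is solved for the products w_x g(x), which are then divided by the weights. It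
    will produce the adjoint solution from prescribed moments. *)
Lemma theta_moment_problem (R : realType) (N : nat) (alpha beta : R)
    (hw : forall x : 'I_N.+1, weight alpha beta x != 0) (p : 'I_N.+1 -> R) :
  exists g : gridfun R N, forall j : 'I_N.+1,
    scalar_product alpha beta g (theta j) = p j.
Proof.
pose A : 'M[R]_N.+1 := \matrix_(i, j) theta j i.
pose a := (\row_j p j) *m invmx A.
exists (fun x => a 0 x / weight alpha beta x) => j.
have /rowP/(_ j) : a *m A = \row_j p j by rewrite mulmxKV // theta_mx_unit.
rewrite mxE [in RHS]mxE => <-; apply: eq_bigr => x _.
by rewrite [A _ _]mxE mulrCA divff // mulr1.
Qed.

Lemma scalar_productZr (R : realType) (N : nat) (alpha beta c : R)
    (f g h : gridfun R N) :
  (forall x, h x = c * g x) ->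
  scalar_product alpha beta f h = c * scalar_product alpha beta f g.
Proof.
by move=> hE; rewrite mulr_sumr; apply: eq_bigr => x _; rewrite hE; ring.
Qed.

Lemma scalar_productZl (R : realType) (N : nat) (alpha beta c : R)
    (f g h : gridfun R N) :
  (forall x, h x = c * g x) ->
  scalar_product alpha beta h f = c * scalar_product alpha beta g f.
Proof.
by move=> hE; rewrite mulr_sumr; apply: eq_bigr => x _; rewrite hE; ring.
Qed.

(** The row of values w_x (f(x) - g(x)) is annihilated by the invertible matrix of the theta_j, and
    the weights are nonzero. *)
Lemma theta_total (R : realType) (N : nat) (alpha beta : R)
    (hw : forall x : 'I_N.+1, weight alpha beta x != 0) (f g : gridfun R N) :
  (forall j : nat, (j <= N)%N -> scalar_product alpha beta f (theta j)
     = scalar_product alpha beta g (theta j)) ->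
  f =1 g.
Proof.
move=> fg x.
pose A : 'M[R]_N.+1 := \matrix_(i, j) theta j i.
pose v := \row_i (weight alpha beta i * (f i - g i)).
have vA0 : v *m A = 0 *m A.
  rewrite mul0mx; apply/rowP => j; rewrite !mxE.
  have /eqP := fg j (ltn_ord j); rewrite -subr_eq0 -sumrB => /eqP e.
rewrite -[RHS]e.
  by apply: eq_bigr => i _; rewrite !mxE; ring.
have /rowP/(_ x) := row_free_inj (etrans (row_free_unit A) (theta_mx_unit R N)) vA0.
by rewrite !mxE => /eqP; rewrite mulf_eq0 (negPf (hw x)) subr_eq0 => /eqP.
Qed.

Lemma scalar_product_opL_theta (R : realType) (N : nat) (alpha beta : R)
    (f : gridfun R N) (j : nat) :
  scalar_product alpha beta f (opL alpha (theta j))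
  = - (alpha + 1 + j%:R) * scalar_product alpha beta f (theta j).
Proof. by apply: scalar_productZr => x; rewrite opL_theta. Qed.

Lemma scalar_product_opM_theta0 (R : realType) (N : nat) (alpha beta : R)
    (f : gridfun R N) :
  scalar_product alpha beta f (opM alpha beta (theta 0)) = 0.
Proof. by rewrite /scalar_product big1 // => x _; rewrite opM_theta0 mulr0. Qed.

Lemma scalar_product_opM_thetaS (R : realType) (N : nat) (alpha beta : R)
    (f : gridfun R N) (j : nat) :
  scalar_product alpha beta f (opM alpha beta (theta j.+1))
  = - j.+1%:R * (alpha + 1 + j.+1%:R) * scalar_product alpha beta f (theta j.+1)
    + (alpha + beta + j.+1%:R) * (N%:R - j%:R)
      * scalar_product alpha beta f (theta j).
Proof.
rewrite /scalar_product !mulr_sumr -big_split /=.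
by apply: eq_bigr => x _; rewrite opM_thetaS; ring.
Qed.

(** Used to see that P_n is not the zero function. *)
Lemma biorthP_ord0 (R : realType) (N : nat) (alpha beta : R) (n : nat) :
  biorthP alpha beta n (ord0 : 'I_N.+1) = 1.
Proof.
rewrite biorthP_sum big_ord_recl big1 ?addr0 => [|k _].
  by rewrite /= !pochhammer0 !ffactn0 fact0 !mulr1 invr1 mulr1.
by rewrite /= ffact0n mulr0.
Qed.

(** * The recurrence for the moments and its solutions *)

Definition biorth_moment {R : realType} (N : nat) (alpha beta : R) (m j : nat) :=
  theta_moment N alpha beta j
  * (pochhammer (- j%:R) m / pochhammer (- N%:R) m).

Lemma biorth_momentS (R : realType) (alpha beta : R) (N m j : nat)
    (hc : pochhammer (- alpha - beta - N%:R) N != 0) (ltjN : (j < N)%N) :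
  (j.+1%:R - m%:R) * (alpha + j.+1%:R) * biorth_moment N alpha beta m j.+1
  = (alpha + beta + j.+1%:R) * (N%:R - j%:R) * biorth_moment N alpha beta m j.
Proof.
apply: (mulIf (_ : j.+1%:R != 0)); first by rewrite pnatr_eq0.
(* Both sides are (-1)^m times the falling factorial of j + 1 of order m + 1. *)
have e : (j.+1%:R - m%:R) * pochhammer (- j.+1%:R : R) m
    = j.+1%:R * pochhammer (- j%:R) m.
  rewrite !pochhammerN_nat mulrCA -natr_ffactS ffactnS natrM /=; ring.
rewrite /biorth_moment.
transitivity ((theta_moment N alpha beta j.+1 * (alpha + j.+1%:R) * j.+1%:R)
  * ((j.+1%:R - m%:R) * pochhammer (- j.+1%:R) m) / pochhammer (- N%:R) m).
  by ring.
by rewrite e theta_momentS //; ring.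
Qed.

Lemma biorth_moment_small (R : realType) (alpha beta : R) (N m j : nat) :
  (j < m)%N -> biorth_moment N alpha beta m j = 0.
Proof.
by move=> ltjm; rewrite /biorth_moment pochhammerN_nat ffact_small // mulr0 mul0r mulr0.
Qed.

Lemma biorth_moment_diag_neq0 (R : realType) (alpha beta : R) (N m : nat)
    (hc : pochhammer (- alpha - beta - N%:R) N != 0)
    (hd : pochhammer (- alpha - N%:R) N != 0) (lemN : (m <= N)%N) :
  biorth_moment N alpha beta m m != 0.
Proof.
have h k : (m <= k)%N -> pochhammer (- k%:R : R) m != 0.
  by move=> lemk; rewrite pochhammerN_nat mulf_eq0 signr_eq0 pnatr_eq0 -lt0n ffact_gt0.
by rewrite /biorth_moment mulf_neq0 ?theta_moment_neq0 // mulf_neq0 ?invr_eq0 ?h.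
Qed.

Lemma scalar_product_neq0 (R : realType) (N : nat) (alpha beta : R)
    (f g : gridfun R N) :
  scalar_product alpha beta f g != 0 -> exists x, f x != 0.
Proof.
move=> fg0; apply: contrapT => /forallNP f0; move/eqP: fg0; apply.
rewrite /scalar_product big1 // => x _.
by have /negP := f0 x; rewrite negbK => /eqP ->; rewrite mulr0 mul0r.
Qed.

(** Going up from j = 0, each value is forced to be zero by the previous one, except at index n,
    where the leading coefficient vanishes and v_n = 0 is supplied. A solution is thus determined by
    v_n. *)
Lemma biorth_recurrence_unique (R : realType) (alpha beta : R) (N n : nat)
    (halpha : forall j : nat, (j < N)%N -> alpha + j.+1%:R != 0)
    (v : nat -> R) :
  (0 - n%:R) * v 0%N = 0 -> v n = 0 ->
  (forall j, (j < N)%N -> (j.+1%:R - n%:R) * (alpha + j.+1%:R) * v j.+1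
     = (alpha + beta + j.+1%:R) * (N%:R - j%:R) * v j) ->
  forall j, (j <= N)%N -> v j = 0.
Proof.
move=> v0 vn vS; elim=> [_|j IHj ltjN].
  have [n0|n0] := eqVneq n 0%N; first by rewrite -{1}n0.
  by move/eqP: v0; rewrite mulf_eq0 sub0r oppr_eq0 pnatr_eq0 (negPf n0) => /eqP.
have [<-//|nej] := eqVneq n j.+1.
have := vS j ltjN; rewrite IHj 1?ltnW // mulr0 => /eqP.
rewrite !mulf_eq0 subr_eq0 eqr_nat eq_sym (negPf nej) (negPf (halpha j ltjN)).
by move/eqP.
Qed.

Theorem proposition4p2 (R : realType) (N : nat) (alpha beta : R)
  (halpha : forall j : nat, (1 <= j <= N.+1)%N -> alpha != - j%:R)
  (hbeta_pos : forall j : nat, (j < N)%N -> beta != j%:R)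
  (hbeta_neg : forall j : nat, (j < N)%N -> beta != - j%:R)
  (halphabeta : forall j : nat, (1 <= j <= N)%N -> alpha + beta != - j%:R)
  (Lstar Mstar : gridfun R N -> gridfun R N)
  (hLstar : is_adjoint alpha beta (opL alpha) Lstar)
  (hMstar : is_adjoint alpha beta (opM alpha beta) Mstar) :
  (forall n : nat, (n <= N)%N ->
    [/\ gevp_solution (opM alpha beta) (opL alpha) n%:R
          (biorthP alpha beta n : gridfun R N),
        (exists Pstar : gridfun R N,
          gevp_solution Mstar Lstar n%:R Pstar
          /\ (forall x, Lstar Pstar x = biorthV alpha beta n x))
      & (forall Pstar : gridfun R N,
          gevp_solution Mstar Lstar n%:R Pstar ->
          exists c : R,
            c != 0 /\ (forall x, Lstar Pstar x = c * biorthV alpha beta n x))])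
  /\ (exists h : nat -> R,
        (forall n : nat, (n <= N)%N -> h n != 0)
        /\ (forall n m : nat, (n <= N)%N -> (m <= N)%N ->
              \sum_(x < N.+1)
                 weight alpha beta x * biorthP alpha beta n x
                   * biorthV alpha beta m x
              = h n * (n == m)%:R)).
Proof.
(* The eigenvalues of L on theta_0, ..., theta_N are nonzero; j = N uses alpha != -(N + 1). *)
have halphaS j : (j <= N)%N -> alpha + 1 + j%:R != 0.
  move=> lejN; apply: contraNneq (halpha j.+1 _) => // h.
  by apply/eqP; rewrite -[LHS]subr0 -h -natr1; ring.
have hc : pochhammer (- alpha - beta - N%:R) N != 0.
  apply: pochhammer_neq0 => i ltiN.
  have := halphabeta (N - i)%N; rewrite subn_gt0 ltiN leq_subr => /(_ isT).
  apply: contraNneq => h; rewrite natrB 1?ltnW //.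
  by apply/eqP; rewrite -[LHS]addr0 -h; ring.
have hd : pochhammer (- alpha - N%:R) N != 0.
  apply: pochhammer_neq0 => i ltiN.
  have := halpha (N - i)%N; rewrite subn_gt0 ltiN leqW ?leq_subr // => /(_ isT).
  apply: contraNneq => h; rewrite natrB 1?ltnW //.
  by apply/eqP; rewrite -[LHS]addr0 -h; ring.
have hbeta x : (x <= N)%N -> pochhammer (1 + beta - x%:R) x != 0.
  move=> lexN; apply: pochhammer_neq0 => i ltix.
  have := hbeta_pos (x - i.+1)%N; rewrite -subSn // subSS => /(_ _).
  rewrite (leq_trans (leq_subr _ _)) // => /(_ isT).
  apply: contraNneq => h; rewrite natrB // -(natr1 i).
  by apply/eqP; rewrite -[LHS]subr0 -h; ring.
have hw (x : 'I_N.+1) : weight alpha beta x != 0.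
  apply: weight_neq0 => //; apply: pochhammer_neq0 => i ltiN.
  by rewrite addrC subr_eq0 eq_sym hbeta_pos.
pose sp := @scalar_product R N alpha beta.
have spC f g : sp f g = sp g f by apply: eq_bigr => x _; ring.
have VE m j : (m <= N)%N -> (j <= N)%N ->
    sp (biorthV alpha beta m) (theta j) = biorth_moment N alpha beta m j.
  by move=> lemN lejN; apply: biorthV_theta.
have LE f j : sp (Lstar f) (theta j) = - (alpha + 1 + j%:R) * sp f (theta j).
  by rewrite /sp -hLstar scalar_product_opL_theta.
have ME0 f : sp (Mstar f) (theta 0) = 0.
  by rewrite /sp -hMstar scalar_product_opM_theta0.
(* The diagonal part of M is expressed through [Lstar f], so that the eigenvalue equation yields a
   recurrence for the moments of [Lstar f]. *)
have MES f j : sp (Mstar f) (theta j.+1)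
    = j.+1%:R * sp (Lstar f) (theta j.+1)
      + (alpha + beta + j.+1%:R) * (N%:R - j%:R) * sp f (theta j).
  by rewrite LE /sp -hMstar scalar_product_opM_thetaS; ring.
have gevpP n : (n <= N)%N -> gevp_solution (opM alpha beta) (opL alpha) n%:R
    (biorthP alpha beta n : gridfun R N).
  move=> lenN; split; last by move=> x; apply: biorthP_gevp_eq.
  by exists ord0; rewrite biorthP_ord0 oner_eq0.
have diag_neq0 n : (n <= N)%N -> biorth_moment N alpha beta n n != 0.
  by move=> lenN; apply: biorth_moment_diag_neq0.
have exP n : (n <= N)%N -> exists Pstar : gridfun R N,
    gevp_solution Mstar Lstar n%:R Pstar
    /\ (forall x, Lstar Pstar x = biorthV alpha beta n x).
  move=> lenN.
  (* The moments of V_n divided by the eigenvalues of L: then [Lstar g] has exactly the moments of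
     V_n. *)
  have [g gE] := theta_moment_problem hw
    (fun j => - biorth_moment N alpha beta n j / (alpha + 1 + j%:R)).
  have {}gE j : (j <= N)%N ->
      sp g (theta j) = - biorth_moment N alpha beta n j / (alpha + 1 + j%:R).
    by rewrite -ltnS => ltjN; rewrite -[j]/(val (Ordinal ltjN)) -gE.
  have LgE x : Lstar g x = biorthV alpha beta n x.
    apply: (theta_total hw) => j lejN.
    by rewrite -/(sp _ _) -/(sp _ _) LE VE // gE //; field; rewrite halphaS.
  exists g; split=> //; split.
    apply: (@scalar_product_neq0 _ _ alpha beta _ (theta n)).
    have := diag_neq0 n lenN; rewrite -VE // -(funext LgE) LE mulf_eq0 negb_or.
    by case/andP.
  apply: (theta_total hw) => j lejN; rewrite -/(sp _ _) -/(sp _ _).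
  have -> : sp (fun x => n%:R * Lstar g x) (theta j)
      = n%:R * biorth_moment N alpha beta n j.
    by rewrite -VE // -(funext LgE); apply: scalar_productZl.
  (* At j = 0 the left side is zero, and so is the right: either n = 0 or (V_n, theta_0) = 0. *)
  case: j lejN => [_|j ltjN].
    rewrite ME0; case: n lenN {gE LgE} => [|n] lenN; first by rewrite mul0r.
    by rewrite biorth_moment_small ?mulr0.
  rewrite MES (funext LgE) VE // gE 1?ltnW //.
  have aj : alpha + j.+1%:R != 0.
    by have := halphaS j (ltnW ltjN); rewrite -natr1 addrA addrAC.
  have := biorth_momentS n hc ltjN => e.
  have -> : alpha + 1 + j%:R = alpha + j.+1%:R by rewrite -natr1; ring.
  have -> : (alpha + beta + j.+1%:R) * (N%:R - j%:R) *
      (- biorth_moment N alpha beta n j / (alpha + j.+1%:R))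
    = - ((alpha + beta + j.+1%:R) * (N%:R - j%:R) * biorth_moment N alpha beta n j)
      / (alpha + j.+1%:R) by ring.
  by rewrite -e; move: aj; set a := alpha + _ => aj; field.
have uniqP n : (n <= N)%N -> forall Pstar : gridfun R N,
    gevp_solution Mstar Lstar n%:R Pstar -> exists c : R,
    c != 0 /\ (forall x, Lstar Pstar x = c * biorthV alpha beta n x).
  move=> lenN P [[x0 Px0] PE].
  pose u := biorth_moment N alpha beta n.
  have un := diag_neq0 n lenN : u n != 0.
  pose v j := sp (Lstar P) (theta j).
  have MP j : sp (Mstar P) (theta j) = n%:R * v j by apply: scalar_productZl.
  have v0 : (0 - n%:R) * v 0%N = 0 by rewrite sub0r mulNr -MP ME0 oppr0.
  have vS j : (j < N)%N -> (j.+1%:R - n%:R) * (alpha + j.+1%:R) * v j.+1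
     = (alpha + beta + j.+1%:R) * (N%:R - j%:R) * v j.
    move=> ltjN; have := MES P j; rewrite MP -/(v j.+1) => e.
    have -> : (j.+1%:R - n%:R) * (alpha + j.+1%:R) * v j.+1
        = (alpha + j.+1%:R) * (j.+1%:R * v j.+1 - n%:R * v j.+1) by ring.
    by rewrite e [v j]LE -natr1; ring.
  (* Both moment sequences satisfy the recurrence, so they are proportional; the factor is read off
     at index n, where the recurrence leaves the value free. *)
  have vu j : (j <= N)%N -> v j = v n / u n * u j.
      move=> lejN; apply/eqP; rewrite -subr_eq0; apply/eqP.
    pose d i := v i - v n / u n * u i.
    apply: (@biorth_recurrence_unique R alpha beta N n _ d) lejN.
    - by move=> i ltiN; have := halphaS i (ltnW ltiN); rewrite -natr1 addrA addrAC.
    - rewrite /d mulrBr v0 mulrCA; case: n {lenN PE un MP v0 vS} @u @d => [|n] u d.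
        by rewrite subrr !(mul0r, mulr0) ?subrr.
      by rewrite /u (biorth_moment_small _ _ _ (ltn0Sn n)) !mulr0 subrr.
    - by rewrite /d divfK ?subrr.
    - by move=> i ltiN; rewrite /d mulrBr vS // mulrCA biorth_momentS // -/(u i); ring.
  have LE' x : Lstar P x = v n / u n * biorthV alpha beta n x.
    apply: (@theta_total _ _ _ _ hw _ (fun x => v n / u n * _ x)) => j lejN.
    rewrite -/(sp _ _) -/(v j) vu //.
    by rewrite -[u j]VE //; apply/esym/scalar_productZl.
  exists (v n / u n); split=> //.
  (* If v_n = 0, all moments of [Lstar P] vanish, hence those of P, and P would be zero. *)
  rewrite mulf_neq0 ?invr_eq0 //; apply: contraNneq Px0 => vn0.
  rewrite -[P x0](subr0) -[0]/((fun=> 0) x0) subr_eq0; apply/eqP.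
  apply: (@theta_total _ _ _ _ hw P (fun=> 0)) => j lejN.
  rewrite [RHS]big1 => [|x _]; last by rewrite mulr0 mul0r.
  have /eqP := vu j lejN; rewrite [v j]LE vn0 !mul0r mulf_eq0 oppr_eq0.
  by rewrite (negPf (halphaS j lejN)) => /eqP.
split=> [n lenN|]; first by split; [exact: gevpP|exact: exP|exact: uniqP].
have orth n m : (n <= N)%N -> (m <= N)%N -> n != m ->
    sp (biorthP alpha beta n) (biorthV alpha beta m) = 0.
  (* With V_m = L* P, moving M and L across the scalar product gives n (V_m, P_n) = m (V_m, P_n). *)
  move=> lenN lemN nem; have [P [[_ PE] /funext <-]] := exP m lemN.
  have [_ LP] := gevpP n lenN.
  have e : n%:R * sp (Lstar P) (biorthP alpha beta n)
      = m%:R * sp (Lstar P) (biorthP alpha beta n).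
    rewrite -(scalar_productZl _ _ _ PE) -/(sp _ _) /sp -hMstar -hLstar.
    by rewrite (scalar_productZr _ _ _ LP).
  apply/eqP; rewrite spC; move/eqP: e; rewrite -subr_eq0 -mulrBl mulf_eq0.
  by rewrite subr_eq0 eqr_nat (negPf nem).
exists (fun n => sp (biorthP alpha beta n) (biorthV alpha beta n)); split; last first.
  move=> n m lenN lemN; have [<-|nem] := eqVneq n m; first by rewrite mulr1.
  by rewrite mulr0; apply: orth.
(* If h_n = 0, then P_n is orthogonal to every V_m; expanding it in the theta_j gives a triangular
   homogeneous system, so P_n = 0, against P_n(0) = 1. *)
move=> n lenN; apply/negP => /eqP h0.
have [a aE] := theta_expansion (biorthP alpha beta n : gridfun R N).
have Pa m : (m <= N)%N -> \sum_(j < N.+1) a j * biorth_moment N alpha beta m j = 0.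
  move=> lemN; transitivity (sp (biorthP alpha beta n) (biorthV alpha beta m)).
    rewrite spC; under eq_bigr => j _ do rewrite -VE -1?ltnS // mulr_sumr.
    rewrite exchange_big; apply: eq_bigr => x _ /=.
    by rewrite aE mulr_sumr; apply: eq_bigr => j _; ring.
  by have [<-//|nem] := eqVneq n m; apply: orth.
(* The coefficients vanish from j = N downwards: in the equation for V_j the terms before j have
   zero moment, and those after j vanish by induction. *)
suff a0 d (j : 'I_N.+1) : (N - j <= d)%N -> a j = 0.
  have := biorthP_ord0 N alpha beta n; rewrite aE big1 => [|j _].
    by move/eqP; rewrite eq_sym oner_eq0.
  by rewrite (a0 N) ?mul0r // leq_subr.
elim: d.+1 {-2}d (ltnSn d) j => // {}d IHd k ltkd j lejk.
have lejN : (j <= N)%N by rewrite -ltnS.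
have := Pa j lejN; rewrite (bigD1 j) //= big1 ?addr0 => [/eqP|i neij].
  by rewrite mulf_eq0 (negPf (diag_neq0 j lejN)) orbF => /eqP.
have [ltij|leji] := ltnP i j; first by rewrite biorth_moment_small ?mulr0.
have ltji : (j < i)%N by rewrite ltn_neqAle leji eq_sym neij.
have ltNij : (N - i < N - j)%N by rewrite ltn_sub2l // (leq_trans ltji) // -ltnS.
by rewrite (IHd (N - i)%N) ?mul0r // (leq_trans ltNij) // (leq_trans lejk).
Qed.
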